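(* Let $f$, $g$, $\xi$, $F$ satisfy the standing assumptions below, and let $x$ be the unique continuous solution of $x'(t)=-f(x(t))+g(t)$, $t>0$, $x(0)=\xi$. Suppose that $f\in\mathrm{RV}_0(\beta)$ for some $\beta>1$, that $g\in\mathrm{RV}_\infty(-\theta)$ for some $\theta>0$, that $x(t)\to0$ as $t\to\infty$, and that \[ \lim_{t\to\infty}\frac{g(t)}{f(F^{-1}(t))}=L\in[0,\infty]. \] (i) If $L=0$, then $\lim_{t\to\infty}F(x(t))/t=1$. (ii) If $L\in(0,\infty)$, then $\lim_{t\to\infty}F(x(t))/t=\Lambda_*$, where $\Lambda_*\in(0,1)$ is the unique solution of $(1-\Lambda_* )\Lambda_*^{-\beta/(\beta-1)}=L$. (iii) If $L=\infty$, then $\lim_{t\to\infty}f(x(t))/g(t)=1$.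
   Context: Standing assumptions: $f\in C(\mathbb{R};\mathbb{R})$ is locally Lipschitz continuous on $\mathbb{R}$, $f(0)=0$ and $xf(x)>0$ for $x\neq0$; $g\in C([0,\infty);\mathbb{R})$ with $g(t)>0$ for $t>0$; $\xi>0$. $F(x)=\int_x^1 \frac{du}{f(u)}$ for $x>0$ (which tends to $+\infty$ as $x\to0^+$ since $f\in\mathrm{RV}_0(\beta)$ with $\beta>1$); $F^{-1}$ is the inverse of the strictly decreasing function $F$. $\mathrm{RV}_0(\beta)$: measurable positive $\varphi$ on $(0,\infty)$ with $\varphi(\lambda x)/\varphi(x)\to\lambda^\beta$ as $x\to0^+$ for every $\lambda>0$. $\mathrm{RV}_\infty(\alpha)$: measurable positive $h$ with $h(\lambda t)/h(t)\to\lambda^\alpha$ as $t\to\infty$ for every $\lambda>0$. *)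

(* Defs.v *)
From Stdlib Require Import Reals Lra ClassicalEpsilon.
Open Scope R_scope.

(* Oriented Riemann integral int_a^b h, chosen classically; 0 if h is not
   Riemann integrable (RiemannInt does not depend on the integrability proof). *)
Definition Rint (h : R -> R) (a b : R) : R :=
  match excluded_middle_informative (inhabited (Riemann_integrable h a b)) with
  | left H =>
      RiemannInt (proj1_sig (constructive_indefinite_description
                    (fun _ : Riemann_integrable h a b => True)
                    (match H with inhabits p => ex_intro _ p I end)))
  | right _ => 0
  end.

(* F(x) = int_x^1 du / f(u)  (meaningful for x > 0). *)
Definition Fof (f : R -> R) (x : R) : R := Rint (fun u => / f u) x 1.

(* F^{-1}(t): some y > 0 with F y = t (unique when it exists, since F is
   strictly decreasing on (0,oo)); arbitrary otherwise. *)
Definition Finv (F : R -> R) (t : R) : R :=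
  epsilon (inhabits 1) (fun y => 0 < y /\ F y = t).

Definition locally_lipschitz (f : R -> R) : Prop :=
  forall a b : R, exists K : R, forall u v : R,
    a <= u <= b -> a <= v <= b -> Rabs (f u - f v) <= K * Rabs (u - v).

Definition continuous_on_nonneg (h : R -> R) : Prop :=
  forall t, 0 <= t -> forall eps, 0 < eps -> exists delta, 0 < delta /\
    forall s, 0 <= s -> Rabs (s - t) < delta -> Rabs (h s - h t) < eps.

Definition lim_at_infty (h : R -> R) (l : R) : Prop :=
  forall eps, 0 < eps -> exists M, forall t, M <= t -> Rabs (h t - l) < eps.

Definition tends_to_infty (h : R -> R) : Prop :=
  forall K, exists M, forall t, M <= t -> K < h t.

Definition lim_at_0_right (h : R -> R) (l : R) : Prop :=
  forall eps, 0 < eps -> exists delta, 0 < delta /\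
    forall x, 0 < x < delta -> Rabs (h x - l) < eps.

Definition RV0 (phi : R -> R) (beta : R) : Prop :=
  (forall x, 0 < x -> 0 < phi x) /\
  forall lam, 0 < lam -> lim_at_0_right (fun x => phi (lam * x) / phi x) (Rpower lam beta).

Definition RVinf (h : R -> R) (alpha : R) : Prop :=
  (forall t, 0 < t -> 0 < h t) /\
  forall lam, 0 < lam -> lim_at_infty (fun t => h (lam * t) / h t) (Rpower lam alpha).

(* Main.v *)
Require Import Defs.
From Stdlib Require Import Reals Ranalysis5 Lra Lia Classical ClassicalEpsilon.
From Coquelicot Require Import Coquelicot.
Open Scope R_scope.

(* In the coordinate z = F(x) the equation reads z' = 1 - g / f(x), and the unperturbed orbit is
   y(t) = F^{-1}(t). Since f is regularly varying, F(lam y) / F(y) -> lam^(1 - beta) as y -> 0, and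
   f is increasing up to a factor arbitrarily close to 1. Hence z <= mu t with
   mu < lam^(1 - beta) forces f(y) / f(x) <= lam^(-beta) + o(1), and symmetrically for z >= mu t.
   With Lam = lam^(1 - beta) the equation for Lam says 1 - L lam^(-beta) = Lam, so z' is bounded
   away from mu on the wrong side of each line z = mu t with mu <> Lam; such a line is crossed
   only once and z / t -> Lam. When L is infinite, the same barrier gives z = o(t); thus f(x) and
   g cannot stay in a ratio away from 1 over a window [q t, t], and since x is monotone in between
   while g barely changes on such a window, they stay comparable. *)

(** * Almost monotonicity of regularly varying functions, by a category argument *)

Lemma continuity_pt_pos_near (h : R -> R) (v : R) :
  continuity_pt h v -> 0 < h v ->
  exists d, 0 < d /\ forall w, Rabs (w - v) < d -> 0 < h w.
Proof.
intros Hc Hv.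
destruct (Hc (h v) Hv) as [d [Hd H]].
exists d; split; [exact Hd|]; intros w Hw.
destruct (Req_dec w v) as [->|Hne]; [exact Hv|].
assert (Hw' : Rabs (h w - h v) < h v).
{ apply H; split; [split; [exact I | now apply not_eq_sym]|exact Hw]. }
apply Rabs_def2 in Hw'; lra.
Qed.

(** The first hypothesis says that each [P n] is closed at the points of [a, b]. If no [P n]
    contained an interval, one could build nested segments, the segment of index n + 1 avoiding
    [P n]; their common point would then lie in no [P n], against the covering. *)
Lemma baire_interval (P : nat -> R -> Prop) (a b : R) :
  a < b ->
  (forall n v, a <= v <= b -> ~ P n v ->
     exists d, 0 < d /\ forall w, Rabs (w - v) < d -> ~ P n w) ->
  (forall v, a <= v <= b -> exists n, P n v) ->
  exists n c d, a <= c /\ c < d /\ d <= b /\ forall v, c <= v <= d -> P n v.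
Proof.
intros Hab Hopen Hcover.
apply NNPP; intros Hno.
(* The conditions on [I] are premises placed after the choice of [J], so that choice yields a total
   function [next] that can be iterated. *)
assert (Hstep : forall n (I : R * R), exists J : R * R,
  a <= fst I /\ fst I < snd I /\ snd I <= b ->
  fst I <= fst J /\ fst J < snd J /\ snd J <= snd I /\
  forall w, fst J <= w <= snd J -> ~ P n w).
{ intros n [c d]; simpl.
  destruct (classic (a <= c /\ c < d /\ d <= b)) as [[Hc [Hcd Hd]]|Hn];
    [|now exists (c, d)].
  assert (Hv : exists v, c <= v <= d /\ ~ P n v).
  { apply NNPP; intros Hv; apply Hno; exists n, c, d.
    repeat split; try assumption.
    intros v Hv'; apply NNPP; intros HP; apply Hv; now exists v. }
  destruct Hv as [v [Hv HP]].
  destruct (Hopen n v) as [e [He Hw]]; [lra|exact HP|].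
  (* The new segment starts at v and extends to the right, unless v is the right end d, where it
     extends to the left. *)
  destruct (Rlt_dec v d) as [Hvd|Hvd].
  - exists (v, Rmin (v + e / 2) d); simpl; intros _.
    assert (Hm := Rmin_l (v + e / 2) d); assert (Hm' := Rmin_r (v + e / 2) d).
    repeat split; try lra; [apply Rmin_glb_lt; lra|].
    intros w Hw'; apply Hw; rewrite Rabs_pos_eq; lra.
  - exists (Rmax c (d - e / 2), d); simpl; intros _.
    assert (Hm := Rmax_l c (d - e / 2)); assert (Hm' := Rmax_r c (d - e / 2)).
    repeat split; try lra; [apply Rmax_lub_lt; lra|].
    intros w Hw'; apply Hw; apply Rabs_def1; lra. }
pose (next n I := proj1_sig (constructive_indefinite_description _ (Hstep n I))).
pose (S := fix S n := match n with O => (a, b) | Datatypes.S m => next m (S m) end).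
assert (HS : forall n, a <= fst (S n) /\ fst (S n) < snd (S n) /\ snd (S n) <= b).
{ induction n as [|n IH]; simpl; [lra|].
  unfold next.
  destruct (constructive_indefinite_description _ (Hstep n (S n))) as [J HJ]; simpl.
  specialize (HJ IH); lra. }
assert (HS' : forall n, fst (S n) <= fst (S (Datatypes.S n)) /\
  snd (S (Datatypes.S n)) <= snd (S n) /\
  forall w, fst (S (Datatypes.S n)) <= w <= snd (S (Datatypes.S n)) -> ~ P n w).
{ intros n; simpl; unfold next.
  destruct (constructive_indefinite_description _ (Hstep n (S n))) as [J HJ]; simpl.
  specialize (HJ (HS n)); tauto. }
assert (Hmon : forall n k, fst (S n) <= fst (S (k + n)%nat) /\
                           snd (S (k + n)%nat) <= snd (S n)).
{ intros n k; induction k as [|k IH]; simpl Nat.add; [lra|].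
  specialize (HS' (k + n)%nat); lra. }
destruct (completeness (fun c => exists n, c = fst (S n))) as [v [Hub Hlub]].
- exists b; intros c [n ->]; specialize (HS n); lra.
- exists a, O; reflexivity.
- assert (Hv : forall n, fst (S n) <= v <= snd (S n)).
  { intros n; split; [apply Hub; now exists n|].
    apply Hlub; intros c [m ->].
    assert (H1 := Hmon n m); assert (H2 := Hmon m n).
    rewrite Nat.add_comm in H2; specialize (HS (m + n)%nat); lra. }
  destruct (Hcover v) as [n Hn]; [exact (Hv O)|].
  destruct (HS' n) as [_ [_ H]]; exact (H v (Hv _) Hn).
Qed.

Lemma Rpower_pos (x y : R) : 0 < Rpower x y.
Proof. apply exp_pos. Qed.

Lemma Rpower_1_l (y : R) : Rpower 1 y = 1.
Proof. unfold Rpower; rewrite ln_1, Rmult_0_r; apply exp_0. Qed.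

Lemma Rpower_Rinv_l (x y : R) : 0 < x -> Rpower (/ x) y = Rpower x (- y).
Proof. intros Hx; unfold Rpower; rewrite ln_Rinv by exact Hx; f_equal; ring. Qed.

(* Baire's theorem plays the role of the uniform convergence theorem for regularly varying
   functions: the ratio is controlled uniformly for dilation factors in some interval [a, b],
   hence in [a / b, 1], and an iteration reaches all factors in (0, 1]. *)
Lemma RV0_almost_increasing (phi : R -> R) (beta : R) :
  (forall u, 0 < u -> continuity_pt phi u) -> 0 < beta -> RV0 phi beta ->
  forall K, 1 < K -> exists d, 0 < d /\
    forall y u, 0 < y -> y <= u -> u < d -> phi y <= K * phi u.
Proof.
intros Hc Hb [Hpos Hrv] K HK.
(* The values at y and at u will both be compared with the value at a third point, each at the cost
   of a factor [k]. *)
pose (k := sqrt K).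
assert (Hk : 1 < k) by (unfold k; rewrite <- sqrt_1; apply sqrt_lt_1_alt; lra).
assert (Hkk : k * k = K) by (unfold k; apply sqrt_sqrt; lra).
(* With [k'] strictly below [k] and l0^beta = 1/k', the limit ratios v^beta for v in [l0, 1] stay in
   [1/k', 1], strictly inside (1/k, k). This leaves room for the error in the limit. *)
pose (k' := (1 + k) / 2).
assert (Hk' : 1 < k' < k) by (unfold k'; lra).
pose (l0 := Rpower k' (- / beta)).
assert (Hl0 : 0 < l0) by apply Rpower_pos.
assert (Hl0' : Rpower l0 beta = / k').
{ unfold l0; rewrite Rpower_mult.
  replace (- / beta * beta) with (- (1)) by (field; lra).
  rewrite Rpower_Ropp, Rpower_1; lra. }
assert (Hl1 : l0 < 1).
{ unfold l0; rewrite <- (Rpower_O k') by lra.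
  apply Rpower_lt; [lra|]. assert (H := Rinv_0_lt_compat _ Hb); lra. }
assert (Hcontrol : forall u v, 0 < u -> 0 < v ->
  continuity_pt (fun w => phi (w * u)) v).
{ intros u v Hu Hv.
  apply (continuity_pt_comp (fun w => w * u) phi).
  - apply derivable_continuous_pt; reg.
  - apply Hc; now apply Rmult_lt_0_compat. }
(* The n-th set holds the dilations v for which phi (v u) / phi u stays in [1/k, k] for all u < 1/(n
   + 1). It is closed because [phi] is continuous, and regular variation makes these sets cover
   [l0, 1]. *)
destruct (baire_interval
  (fun n v => forall u, 0 < u < / INR (S n) ->
     phi u <= k * phi (v * u) /\ phi (v * u) <= k * phi u) l0 1 Hl1)
  as [n [a [b [Ha [Hab [Hb1 Hunif]]]]]].
- intros n v Hv Hn.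
  apply not_all_ex_not in Hn; destruct Hn as [u Hn].
  apply imply_to_and in Hn; destruct Hn as [Hu Hn].
  destruct (Rlt_dec (k * phi (v * u)) (phi u)) as [H|H].
  + destruct (continuity_pt_pos_near (fun w => phi u - k * phi (w * u)) v)
      as [d [Hd Hw]].
    * apply continuity_pt_minus; [apply continuity_pt_const; now intros ? ?|].
      apply continuity_pt_scal, Hcontrol; lra.
    * lra.
    * exists d; split; [exact Hd|]; intros w Hwv HP.
      specialize (Hw w Hwv); specialize (HP u Hu); simpl in *; lra.
  + destruct (continuity_pt_pos_near (fun w => phi (w * u) - k * phi u) v)
      as [d [Hd Hw]].
    * apply continuity_pt_minus; [|apply continuity_pt_const; now intros ? ?].
      apply Hcontrol; lra.
    * destruct (Rlt_dec (k * phi u) (phi (v * u))); [lra|].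
      exfalso; apply Hn; lra.
    * exists d; split; [exact Hd|]; intros w Hwv HP.
      specialize (Hw w Hwv); specialize (HP u Hu); simpl in *; lra.
- intros v Hv.
  assert (Hv1 : / k' <= Rpower v beta).
  { rewrite <- Hl0'; apply Rle_Rpower_l; lra. }
  assert (Hv2 : Rpower v beta <= 1).
  { rewrite <- (Rpower_1_l beta); apply Rle_Rpower_l; lra. }
  assert (Hkk' : / k < / k') by (apply Rinv_lt_contravar; [apply Rmult_lt_0_compat|]; lra).
  destruct (Hrv v) with (eps := Rmin (/ k' - / k) (k - 1)) as [d [Hd Hlim]]; [lra|apply Rmin_pos; lra|].
  destruct (archimed_cor1 d Hd) as [N [HN HN0]].
  exists N; intros u Hu.
  assert (Hud : 0 < u < d).
  { split; [lra|]. apply Rlt_trans with (1 := proj2 Hu), Rlt_trans with (2 := HN).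
    apply Rinv_lt_contravar; [apply Rmult_lt_0_compat; apply lt_0_INR; lia|].
    apply lt_INR; lia. }
  specialize (Hlim u Hud).
  assert (Hm1 := Rmin_l (/ k' - / k) (k - 1)); assert (Hm2 := Rmin_r (/ k' - / k) (k - 1)).
  apply Rabs_def2 in Hlim.
  assert (Hpu := Hpos u (proj1 Hud)).
  assert (Hq : phi (v * u) = phi (v * u) / phi u * phi u) by (field; lra).
  set (q := phi (v * u) / phi u) in *.
  rewrite Hq; split.
  + assert (Hq1 : 1 <= k * q).
    { rewrite <- (Rinv_r k) by lra; apply Rmult_le_compat_l; lra. }
    nra.
  + apply Rmult_le_compat_r; lra.
(* For y in [q u, u], both y and u are dilations of u / b by factors in [a, b], so the uniform bound
   applies twice. *)
- pose (q := a / b).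
  assert (Hq : 0 < q < 1).
  { unfold q; split; [apply Rdiv_lt_0_compat; lra|].
    apply Rmult_lt_reg_r with b; [lra|]; field_simplify; lra. }
  assert (Hbase : exists d, 0 < d /\ forall y u, q * u <= y <= u -> 0 < u < d ->
                    phi y <= K * phi u).
  { exists (b * / INR (S n)); split.
    - apply Rmult_lt_0_compat; [lra|]; apply Rinv_0_lt_compat, lt_0_INR; lia.
    - intros y u Hy Hu.
      assert (Hu' : 0 < u / b < / INR (S n)).
      { split; [apply Rdiv_lt_0_compat; lra|].
        apply Rmult_lt_reg_r with b; [lra|]. unfold Rdiv; rewrite Rmult_assoc, Rinv_l; lra. }
      assert (Hs : a <= y / u * b <= b).
      { assert (q <= y / u <= 1).
        { split; apply Rmult_le_reg_r with u; try lra; unfold Rdiv; rewrite Rmult_assoc, Rinv_l; lra. }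
        assert (q * b = a) by (unfold q; field; lra). nra. }
      destruct (Hunif _ Hs _ Hu') as [_ H1].
      destruct (Hunif b (conj (Rlt_le _ _ Hab) (Rle_refl b)) _ Hu') as [H2 _].
      replace (y / u * b * (u / b)) with y in H1 by (field; lra).
      replace (b * (u / b)) with u in H2 by (field; lra).
      rewrite <- Hkk; nra. }
  destruct Hbase as [d1 [Hd1 Hbase]].
  (* As q^beta < 1, passing from u to q u does not increase [phi] near 0. Hence any number of such
     steps is free, and only the last comparison costs the factor [K]. *)
  assert (Hqb : Rpower q beta < 1).
  { rewrite <- (Rpower_1_l beta); apply Rlt_Rpower_l; lra. }
  destruct (Hrv q (proj1 Hq) (1 - Rpower q beta)) as [d2 [Hd2 Hstep]]; [lra|].
  exists (Rmin d1 d2); split; [now apply Rmin_pos|].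
  assert (Hiter : forall m y u, q ^ m * u <= y <= u -> 0 < u < Rmin d1 d2 ->
                    phi y <= K * phi u).
  { assert (Hm1 := Rmin_l d1 d2); assert (Hm2 := Rmin_r d1 d2).
    induction m as [|m IH]; simpl; intros y u Hy Hu.
    - apply Hbase; [nra|lra].
    - destruct (Rle_dec (q * u) y) as [Hqy|Hqy]; [apply Hbase; lra|].
      apply Rle_trans with (K * phi (q * u)).
      + apply IH; nra.
      + apply Rmult_le_compat_l; [lra|].
        specialize (Hstep u ltac:(lra)); apply Rabs_def2 in Hstep.
        assert (Hpu := Hpos u (proj1 Hu)).
        replace (phi (q * u)) with (phi (q * u) / phi u * phi u) by (field; lra).
        nra. }
  intros y u Hy Hyu Hud.
  destruct (pow_lt_1_zero q) with (y := y / u) as [m Hm];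
    [rewrite Rabs_pos_eq; lra|apply Rdiv_lt_0_compat; lra|].
  specialize (Hm m (le_n m)).
  apply (Hiter m); [|lra].
  split; [|exact Hyu].
  apply Rabs_def2 in Hm.
  replace y with (y / u * u) by (field; lra).
  apply Rmult_le_compat_r; lra.
Qed.

(** * The primitive [Fof f], its growth at 0 and its inverse *)

Lemma Rint_RInt (h : R -> R) (a b : R) : ex_RInt h a b -> Rint h a b = RInt h a b.
Proof.
intros Hex; unfold Rint.
destruct (excluded_middle_informative _) as [H|H].
- symmetry; apply RInt_Reals.
- exfalso; apply H; constructor; now apply ex_RInt_Reals_0.
Qed.

Lemma Fof_derive (f : R -> R) :
  continuity f -> (forall u, 0 < u -> 0 < f u) ->
  forall u, 0 < u -> derivable_pt_lim (Fof f) u (- / f u).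
Proof.
intros Hc Hpos u Hu.
assert (Hcont : forall v, 0 < v -> continuous (fun w => / f w) v).
{ intros v Hv; apply continuity_pt_filterlim.
  apply continuity_pt_inv; [apply Hc|]. specialize (Hpos v Hv); lra. }
assert (Hex : forall v, 0 < v -> ex_RInt (fun w => / f w) v 1).
{ intros v Hv; apply (ex_RInt_continuous (V := R_CompleteNormedModule)).
  intros w Hw; apply Hcont.
  assert (0 < Rmin v 1) by (apply Rmin_pos; lra); lra. }
assert (Hloc : locally u (fun v => 0 < v)).
{ exists (mkposreal u Hu); intros v Hv; simpl in Hv.
  apply Rabs_def2 in Hv; unfold minus, plus, opp in Hv; simpl in Hv; lra. }
apply is_derive_Reals.
apply (is_derive_ext_loc (fun v => RInt (fun w => / f w) v 1)).
- revert Hloc; apply filter_imp; intros v Hv.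
  symmetry; now apply Rint_RInt, Hex.
- apply (is_derive_RInt' (V := R_CompleteNormedModule) (fun w => / f w) _ u 1); [|now apply Hcont].
  revert Hloc; apply filter_imp; intros v Hv.
  now apply (RInt_correct (V := R_CompleteNormedModule)), Hex.
Qed.

Lemma Fof_1 (f : R -> R) : Fof f 1 = 0.
Proof.
unfold Fof; rewrite Rint_RInt; [apply (RInt_point (V := R_CompleteNormedModule))|].
apply (ex_RInt_point (V := R_CompleteNormedModule)).
Qed.

Lemma decreasing_of_derive (G G' : R -> R) (a b : R) :
  a < b -> (forall c, a <= c <= b -> derivable_pt_lim G c (G' c)) ->
  (forall c, a < c < b -> G' c <= 0) -> G b <= G a.
Proof.
intros Hab Hd Hneg.
destruct (MVT_cor2 G G' a b Hab Hd) as [c [Hc Hcab]].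
specialize (Hneg c Hcab); nra.
Qed.

(* f is at most linear near 0, so F grows at least logarithmically. *)
Lemma Fof_infty (f : R -> R) :
  continuity f -> (forall u, 0 < u -> 0 < f u) -> f 0 = 0 -> locally_lipschitz f ->
  forall K, exists d, 0 < d /\ forall y, 0 < y < d -> K < Fof f y.
Proof.
intros Hc Hpos H0 Hlip K.
destruct (Hlip 0 1) as [C HC].
assert (HfC : forall u, 0 < u <= 1 -> f u <= C * u).
{ intros u Hu; specialize (HC u 0 ltac:(lra) ltac:(lra)).
  rewrite H0, !Rminus_0_r, !Rabs_pos_eq in HC; [lra|lra|]. specialize (Hpos u); lra. }
assert (HCpos : 0 < C) by (specialize (HfC 1); specialize (Hpos 1); lra).
exists (Rmin 1 (exp (- (C * K)))); split; [apply Rmin_pos; [lra|apply exp_pos]|].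
intros y Hy.
assert (Hm1 := Rmin_l 1 (exp (- (C * K)))); assert (Hm2 := Rmin_r 1 (exp (- (C * K)))).
assert (Hln : C * K < - ln y).
{ assert (H : ln y < ln (exp (- (C * K)))) by (apply ln_increasing; lra).
  rewrite ln_exp in H; lra. }
(* Since f u <= C u on (0, 1], adding ln u / C to [Fof f] still gives a nonincreasing function
   there; this bounds [Fof f y] below by - ln y / C. *)
assert (Hdec : Fof f 1 + / C * ln 1 <= Fof f y + / C * ln y).
{ apply (decreasing_of_derive (fun u => Fof f u + / C * ln u)
                              (fun u => - / f u + / C * / u)); [lra| |].
  - intros c Hcy; apply (derivable_pt_lim_plus (Fof f)).
    + apply Fof_derive; [exact Hc|exact Hpos|lra].
    + apply (derivable_pt_lim_scal ln), derivable_pt_lim_ln; lra.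
  - intros c Hcy.
    assert (H : / (C * c) <= / f c).
    { apply Rinv_le_contravar; [apply Hpos|apply HfC]; lra. }
    rewrite Rinv_mult in H; lra. }
rewrite Fof_1, ln_1 in Hdec.
apply Rmult_lt_reg_l with C; [exact HCpos|].
assert (Hm : C * (/ C * ln y) = ln y) by (field; lra).
nra.
Qed.

Lemma Finv_spec (F : R -> R) :
  (forall u, 0 < u -> continuity_pt F u) ->
  (forall K, exists d, 0 < d /\ forall y, 0 < y < d -> K < F y) ->
  forall t, F 1 < t -> 0 < Finv F t /\ F (Finv F t) = t.
Proof.
intros Hc Hinf t Ht; unfold Finv.
apply (epsilon_spec (inhabits 1) (fun y => 0 < y /\ F y = t)).
destruct (Hinf t) as [d [Hd HF]].
pose (a := Rmin (d / 2) (1 / 2)).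
assert (Ha : 0 < a) by (apply Rmin_pos; lra).
assert (Hm1 := Rmin_l (d / 2) (1 / 2)); assert (Hm2 := Rmin_r (d / 2) (1 / 2)).
fold a in Hm1, Hm2.
destruct (IVT_interv (fun y => t - F y) a 1) as [y [Hy HFy]].
- intros v Hv; apply continuity_pt_minus; [apply continuity_pt_const; now intros ? ?|].
  apply Hc; lra.
- lra.
- specialize (HF a); lra.
- lra.
- exists y; lra.
Qed.

(** * Comparing values of [f] through values of its primitive *)

(** For c between [mu] and lam^(1 - beta), regular variation makes F (lam y) - c F y nonincreasing
    near 0, hence bounded below as y tends to 0. The divergence of [F] lets (c - mu) F y absorb that
    bound. *)
Lemma primitive_scale (f F : R -> R) (beta : R) :
  RV0 f beta ->
  (forall u, 0 < u -> derivable_pt_lim F u (- / f u)) ->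
  (forall K, exists d, 0 < d /\ forall y, 0 < y < d -> K < F y) ->
  forall lam mu, 0 < lam -> mu < Rpower lam (1 - beta) ->
  exists d, 0 < d /\ forall y, 0 < y < d -> mu * F y < F (lam * y).
Proof.
intros [Hpos Hrv] HF Hinf lam mu Hlam Hmu.
(* The maximum with 0 keeps [c] positive even when [mu] is negative, since [c] is divided by
   below. *)
pose (c := (Rmax mu 0 + Rpower lam (1 - beta)) / 2).
assert (Hc : mu < c < Rpower lam (1 - beta) /\ 0 < c).
{ assert (H := Rpower_pos lam (1 - beta)).
  assert (H1 := Rmax_l mu 0); assert (H2 := Rmax_r mu 0).
  assert (H3 : Rmax mu 0 < Rpower lam (1 - beta)) by (apply Rmax_lub_lt; lra).
  unfold c; lra. }
assert (Hlc : Rpower lam beta < lam / c).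
{ apply Rmult_lt_reg_r with c; [lra|].
  unfold Rdiv; rewrite Rmult_assoc, Rinv_l, Rmult_1_r by lra.
  apply Rlt_le_trans with (Rpower lam beta * Rpower lam (1 - beta)).
  - apply Rmult_lt_compat_l; [apply Rpower_pos|lra].
  - rewrite <- Rpower_plus; replace (beta + (1 - beta)) with 1 by ring.
    rewrite Rpower_1; lra. }
destruct (Hrv lam Hlam (lam / c - Rpower lam beta)) as [d1 [Hd1 Hd]]; [lra|].
pose (b := d1 / 2).
pose (D := fun y => F (lam * y) - c * F y).
assert (HD : forall y, 0 < y < b -> D b <= D y).
{ intros y Hy; unfold b in *.
  apply (decreasing_of_derive D (fun u => - / f (lam * u) * lam - c * (- / f u))); [lra| |].
  - intros u Hu; unfold D.
    apply (derivable_pt_lim_minus (fun y => F (lam * y)) (fun y => c * F y)).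
    + apply (derivable_pt_lim_comp (fun y => lam * y) F).
      * apply is_derive_Reals; auto_derive; [exact I|ring].
      * apply HF, Rmult_lt_0_compat; lra.
    + apply (derivable_pt_lim_scal F), HF; lra.
  - intros u Hu.
    assert (Hfu : 0 < f u) by (apply Hpos; lra).
    assert (Hflu : 0 < f (lam * u)) by (apply Hpos, Rmult_lt_0_compat; lra).
    specialize (Hd u ltac:(lra)); apply Rabs_def2 in Hd.
    assert (Hr : f (lam * u) <= lam / c * f u).
    { replace (f (lam * u)) with (f (lam * u) / f u * f u) by (field; lra).
      apply Rmult_le_compat_r; lra. }
    assert (H : c * / f u <= lam * / f (lam * u)); [|lra].
    apply Rmult_le_reg_r with (f u * f (lam * u)); [now apply Rmult_lt_0_compat|].
    replace (c * / f u * (f u * f (lam * u))) with (c * f (lam * u)) by (field; lra).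
    replace (lam * / f (lam * u) * (f u * f (lam * u))) with (lam * f u) by (field; lra).
    replace (lam * f u) with (c * (lam / c * f u)) by (field; lra).
    apply Rmult_le_compat_l; lra. }
destruct (Hinf (- D b / (c - mu))) as [d2 [Hd2 HF2]].
exists (Rmin b d2); split; [apply Rmin_pos; unfold b; lra|].
intros y Hy.
assert (Hm1 := Rmin_l b d2); assert (Hm2 := Rmin_r b d2).
specialize (HD y ltac:(lra)); specialize (HF2 y ltac:(lra)).
apply (Rmult_lt_compat_l (c - mu)) in HF2; [|lra].
replace ((c - mu) * (- D b / (c - mu))) with (- D b) in HF2 by (field; lra).
unfold D at 2 in HD; lra.
Qed.

Lemma primitive_strictly_decreasing (f F : R -> R) :
  (forall u, 0 < u -> 0 < f u) ->
  (forall u, 0 < u -> derivable_pt_lim F u (- / f u)) ->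
  forall u v, 0 < u -> u < v -> F v < F u.
Proof.
intros Hpos HF u v Hu Huv.
destruct (MVT_cor2 F (fun w => - / f w) u v Huv) as [c [Hc Hcuv]].
- intros w Hw; apply HF; lra.
- assert (H : 0 < / f c) by (apply Rinv_0_lt_compat, Hpos; lra). nra.
Qed.

(** From F u <= mu F y < F (lam y) and the monotonicity of [F] one gets lam y <= u. Then f (lam y)
    is at most f u up to a factor near 1, and f y / f (lam y) tends to lam^(- beta). *)
Lemma compare_of_primitive (f F : R -> R) (beta : R) :
  continuity f -> 0 < beta -> RV0 f beta ->
  (forall u, 0 < u -> derivable_pt_lim F u (- / f u)) ->
  (forall K, exists d, 0 < d /\ forall y, 0 < y < d -> K < F y) ->
  forall lam mu eps, 0 < lam -> mu < Rpower lam (1 - beta) -> 0 < eps ->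
  exists d, 0 < d /\ forall u y, 0 < u < d -> 0 < y < d ->
    F u <= mu * F y -> f y <= (Rpower lam (- beta) + eps) * f u.
Proof.
intros Hc Hb Hrv HF Hinf lam mu eps Hlam Hmu Heps.
destruct (primitive_scale f F beta Hrv HF Hinf lam mu Hlam Hmu) as [d1 [Hd1 Hscale]].
pose (P := Rpower lam (- beta)).
assert (HP : 0 < P) by apply Rpower_pos.
(* Half of [eps] is spent on the limit of the ratio; [K] is what remains for the almost
   monotonicity, as (P + eps / 2) K = P + eps. *)
pose (K := (P + eps) / (P + eps / 2)).
assert (HK : 1 < K).
{ unfold K; apply Rmult_lt_reg_r with (P + eps / 2); [lra|].
  unfold Rdiv at 2; rewrite Rmult_assoc, Rinv_l; lra. }
destruct (RV0_almost_increasing f beta) with (K := K) as [d2 [Hd2 Hmono]];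
  [intros u _; apply Hc|exact Hb|exact Hrv|exact HK|].
destruct Hrv as [Hpos Hrv].
destruct (Hrv (/ lam)) with (eps := eps / 2) as [d3 [Hd3 Hratio]];
  [now apply Rinv_0_lt_compat|lra|].
rewrite Rpower_Rinv_l in Hratio by exact Hlam; fold P in Hratio |- *.
exists (Rmin d1 (Rmin d2 (d3 / lam))); split.
{ repeat apply Rmin_pos; try assumption; now apply Rdiv_lt_0_compat. }
intros u y Hu Hy HFu.
assert (Hm1 := Rmin_l d1 (Rmin d2 (d3 / lam))).
assert (Hm2 := Rmin_r d1 (Rmin d2 (d3 / lam))).
assert (Hm3 := Rmin_l d2 (d3 / lam)); assert (Hm4 := Rmin_r d2 (d3 / lam)).
assert (Hly : 0 < lam * y) by (apply Rmult_lt_0_compat; lra).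
assert (Hlu : lam * y <= u).
{ apply Rnot_lt_le; intros Hlt.
  assert (H := primitive_strictly_decreasing f F Hpos HF u (lam * y) ltac:(lra) Hlt).
  specialize (Hscale y); lra. }
assert (H1 : f (lam * y) <= K * f u) by (apply Hmono; lra).
assert (H2 : f y <= (P + eps / 2) * f (lam * y)).
{ assert (Hl3 : lam * y < d3).
  { replace d3 with (lam * (d3 / lam)) by (field; lra).
    apply Rmult_lt_compat_l; lra. }
  specialize (Hratio (lam * y) (conj Hly Hl3)).
  replace (/ lam * (lam * y)) with y in Hratio by (field; lra).
  apply Rabs_def2 in Hratio.
  assert (Hf := Hpos _ Hly).
  replace (f y) with (f y / f (lam * y) * f (lam * y)) by (field; lra).
  apply Rmult_le_compat_r; lra. }
apply Rle_trans with (1 := H2).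
replace (P + eps) with ((P + eps / 2) * K) by (unfold K; field; lra).
rewrite Rmult_assoc; apply Rmult_le_compat_l; lra.
Qed.

(** * Barrier arguments for differentiable functions *)

Lemma last_nonneg (h : R -> R) (a b s0 : R) :
  (forall t, a <= t <= b -> continuity_pt h t) ->
  a <= s0 <= b -> 0 <= h s0 -> h b < 0 ->
  exists s, a <= s < b /\ 0 <= h s /\ forall t, s < t <= b -> h t < 0.
Proof.
intros Hc Hs0 Hh0 Hhb.
destruct (completeness (fun t => a <= t <= b /\ 0 <= h t)) as [s [Hub Hlub]].
- exists b; intros t Ht; lra.
- now exists s0.
- assert (Hsb : s <= b) by (apply Hlub; intros t Ht; lra).
  assert (Has : s0 <= s) by (apply Hub; lra).
  assert (Hhs : 0 <= h s).
  { apply Rnot_lt_le; intros Hneg.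
    destruct (continuity_pt_pos_near (fun t => - h t) s) as [d [Hd Hnear]].
    - apply continuity_pt_opp, Hc; lra.
    - lra.
    - assert (H : s <= s - d); [|lra].
      apply Hlub; intros t [Ht Hht].
      apply Rnot_lt_le; intros Htd.
      assert (Hts : t <= s) by (apply Hub; lra).
      specialize (Hnear t ltac:(apply Rabs_def1; lra)); lra. }
  exists s; repeat split; try lra.
  + destruct Hsb as [Hsb| ->]; [exact Hsb|lra].
  + intros t Ht; apply Rnot_le_lt; intros Hht.
    assert (H : t <= s) by (apply Hub; lra); lra.
Qed.

Lemma stays_nonneg (h h' : R -> R) (T : R) :
  (forall t, T <= t -> derivable_pt_lim h t (h' t)) ->
  (forall t, T <= t -> h t < 0 -> 0 < h' t) ->
  0 <= h T -> forall t, T <= t -> 0 <= h t.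
Proof.
intros Hd Hpos HT t Ht; apply Rnot_lt_le; intros Hneg.
destruct (last_nonneg h T t T) as [s [Hs [Hhs Hlast]]]; try lra.
- intros u Hu; apply derivable_continuous_pt.
  exists (h' u); apply Hd; lra.
- destruct (MVT_cor2 h h' s t) as [c [Hc Hcst]]; [lra|intros c Hc; apply Hd; lra|].
  assert (Hh'c := Hpos c ltac:(lra) (Hlast c ltac:(lra))).
  assert (0 < h' c * (t - s)) by (apply Rmult_lt_0_compat; lra); lra.
Qed.

(** A function that stayed negative from [T] on would rise at rate at least k and reach 0 by time T
    - h T / k. Once nonnegative, it remains so by [stays_nonneg]. *)
Lemma eventually_nonneg (h h' : R -> R) (T k : R) :
  0 < k ->
  (forall t, T <= t -> derivable_pt_lim h t (h' t)) ->
  (forall t, T <= t -> h t < 0 -> k <= h' t) ->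
  exists T', forall t, T' <= t -> 0 <= h t.
Proof.
intros Hk Hd Hpos.
destruct (classic (exists t0, T <= t0 /\ 0 <= h t0)) as [[t0 [Ht0 Hh]]|Hno].
- exists t0; apply (stays_nonneg h h').
  + intros t Ht; apply Hd; lra.
  + intros t Ht Hneg; specialize (Hpos t ltac:(lra) Hneg); lra.
  + exact Hh.
- exfalso.
  assert (Hneg : forall t, T <= t -> h t < 0).
  { intros t Ht; apply Rnot_le_lt; intros Hh; apply Hno; now exists t. }
  assert (HT := Hneg T (Rle_refl T)).
  assert (Hw : 0 < - h T / k) by (apply Rdiv_lt_0_compat; lra).
  destruct (MVT_cor2 h h' T (T + - h T / k)) as [c [Hc Hcst]];
    [lra|intros c Hc; apply Hd; lra|].
  assert (Hh'c := Hpos c ltac:(lra) (Hneg c ltac:(lra))).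
  assert (Hend := Hneg (T + - h T / k) ltac:(lra)).
  replace (T + - h T / k - T) with (- h T / k) in Hc by ring.
  assert (H : k * (- h T / k) = - h T) by (field; lra).
  nra.
Qed.

(** * Linear barriers for [F (x t)] and the limit of [F (x t) / t] *)

(* Solving F (y t) = t makes y an orbit of the unperturbed equation y' = - f y. *)
Record perturbed_orbit {f F g x y : R -> R} {beta T : R} : Prop := {
  po_beta : 1 < beta;
  po_T : 0 < T;
  po_cont : continuity f;
  po_RV : RV0 f beta;
  po_F : forall u, 0 < u -> derivable_pt_lim F u (- / f u);
  po_Finf : forall K, exists d, 0 < d /\ forall u, 0 < u < d -> K < F u;
  po_g : forall t, T <= t -> 0 < g t;
  po_x : forall t, T <= t -> 0 < x t;
  po_xd : forall t, T <= t -> derivable_pt_lim x t (- f (x t) + g t);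
  po_x0 : forall d, 0 < d -> exists M, forall t, M <= t -> x t < d;
  po_y : forall t, T <= t -> 0 < y t /\ F (y t) = t;
  po_y0 : forall d, 0 < d -> exists M, forall t, M <= t -> y t < d
}.

Arguments perturbed_orbit : clear implicits.

Lemma po_pos {f F g x y : R -> R} {beta T : R} :
  perturbed_orbit f F g x y beta T -> forall u, 0 < u -> 0 < f u.
Proof. intros H; exact (proj1 (po_RV H)). Qed.

Lemma po_zd {f F g x y : R -> R} {beta T : R} :
  perturbed_orbit f F g x y beta T -> forall t, T <= t ->
  derivable_pt_lim (fun s => F (x s)) t (1 - g t / f (x t)).
Proof.
intros H t Ht.
assert (Hx := po_x H t Ht).
assert (Hf := po_pos H _ Hx).
replace (1 - g t / f (x t)) with (- / f (x t) * (- f (x t) + g t)) by (field; lra).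
apply (derivable_pt_lim_comp x F).
- now apply (po_xd H).
- now apply (po_F H).
Qed.

(** Below the line mu t, [compare_of_primitive] bounds f (y t) / f (x t) by nearly lam^(- beta), so
    g / f (x) is at most nearly r lam^(- beta) and F (x t) - mu t grows at a definite rate. *)
Lemma orbit_lower {f F g x y : R -> R} {beta T : R} :
  perturbed_orbit f F g x y beta T ->
  forall lam mu r, 0 < lam -> mu < Rpower lam (1 - beta) -> 0 <= r ->
  r * Rpower lam (- beta) < 1 - mu ->
  (exists M, forall t, M <= t -> g t <= r * f (y t)) ->
  exists M, forall t, M <= t -> mu * t <= F (x t).
Proof.
intros H lam mu r Hlam Hmu Hr Hrmu [M1 Hg].
pose (P := Rpower lam (- beta)); fold P in Hrmu.
(* This [e] solves r (P + e) = 1 - mu - e: it is both the error allowed in the comparison and the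
   growth rate obtained. *)
pose (e := (1 - mu - r * P) / (r + 1)).
assert (He : 0 < e) by (apply Rdiv_lt_0_compat; lra).
assert (Hre : r * e + e = 1 - mu - r * P) by (unfold e; field; lra).
assert (Hb := po_beta H).
destruct (compare_of_primitive f F beta (po_cont H) ltac:(lra)
  (po_RV H) (po_F H) (po_Finf H)
  lam mu e Hlam Hmu He) as [d [Hd Hcmp]].
destruct (po_x0 H d Hd) as [M2 Hx0].
destruct (po_y0 H d Hd) as [M3 Hy0].
destruct (eventually_nonneg (fun t => F (x t) - mu * t)
  (fun t => (1 - g t / f (x t)) - mu) (Rmax (Rmax T M1) (Rmax M2 M3)) e He)
  as [M HM].
- intros t Ht.
  assert (HtT : T <= t) by (eapply Rle_trans; [|exact Ht]; eapply Rle_trans; apply Rmax_l).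
  apply (derivable_pt_lim_minus (fun t => F (x t))).
  + now apply (po_zd H).
  + apply is_derive_Reals; auto_derive; [exact I|ring].
- intros t Ht Hneg.
  assert (Hm1 := Rmax_l (Rmax T M1) (Rmax M2 M3)).
  assert (Hm2 := Rmax_r (Rmax T M1) (Rmax M2 M3)).
  assert (Hm3 := Rmax_l T M1); assert (Hm4 := Rmax_r T M1).
  assert (Hm5 := Rmax_l M2 M3); assert (Hm6 := Rmax_r M2 M3).
  destruct (po_y H t ltac:(lra)) as [Hy HFy].
  assert (Hx := po_x H t ltac:(lra)).
  specialize (Hg t ltac:(lra)); specialize (Hx0 t ltac:(lra)); specialize (Hy0 t ltac:(lra)).
  specialize (Hcmp (x t) (y t) (conj Hx Hx0) (conj Hy Hy0) ltac:(rewrite HFy; lra)).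
  fold P in Hcmp.
  assert (Hf := po_pos H _ Hx).
  assert (Hq : g t / f (x t) <= r * (P + e)); [|lra].
  apply Rmult_le_reg_r with (f (x t)); [exact Hf|].
  unfold Rdiv; rewrite Rmult_assoc, Rinv_l, Rmult_1_r by lra.
  apply Rle_trans with (1 := Hg); rewrite Rmult_assoc.
  now apply Rmult_le_compat_l.
- exists M; intros t Ht; specialize (HM t Ht); simpl in HM; lra.
Qed.

(** Mirror image of [orbit_lower]: above the line mu t the comparison is applied with 1/lam and 1/mu
    and with the roles of [x t] and [y t] exchanged. *)
Lemma orbit_upper {f F g x y : R -> R} {beta T : R} :
  perturbed_orbit f F g x y beta T ->
  forall lam mu r, 0 < lam -> Rpower lam (1 - beta) < mu ->
  (1 - mu) * Rpower lam beta < r ->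
  (exists M, forall t, M <= t -> r * f (y t) <= g t) ->
  exists M, forall t, M <= t -> F (x t) <= mu * t.
Proof.
intros H lam mu r Hlam Hmu Hrmu [M1 Hg].
pose (P := Rpower lam beta); fold P in Hrmu.
assert (HP : 0 < P) by apply Rpower_pos.
assert (Hmupos : 0 < mu) by (assert (HL := Rpower_pos lam (1 - beta)); lra).
(* The cap at 1 gives e^2 <= e when (1 - mu + e) (P + e) is expanded; the absolute value is there
   because [mu] may exceed 1. *)
pose (e := Rmin 1 ((r - (1 - mu) * P) / (2 + Rabs (1 - mu) + P))).
assert (Habs := Rabs_pos (1 - mu)); assert (Habs' := Rle_abs (1 - mu)).
assert (He : 0 < e) by (apply Rmin_pos; [lra|apply Rdiv_lt_0_compat; lra]).
assert (He1 : e <= 1) by apply Rmin_l.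
assert (Hre : (1 - mu + e) * (P + e) <= r).
{ assert (He2 : e * (2 + Rabs (1 - mu) + P) <= r - (1 - mu) * P).
  { replace (r - (1 - mu) * P) with
      ((r - (1 - mu) * P) / (2 + Rabs (1 - mu) + P) * (2 + Rabs (1 - mu) + P))
      by (field; lra).
    apply Rmult_le_compat_r; [lra|apply Rmin_r]. }
  nra. }
assert (Hb := po_beta H).
assert (Hmu' : / mu < Rpower (/ lam) (1 - beta)).
{ rewrite Rpower_Rinv_l, Rpower_Ropp by exact Hlam.
  apply Rinv_lt_contravar; [|exact Hmu].
  apply Rmult_lt_0_compat; [apply Rpower_pos|exact Hmupos]. }
destruct (compare_of_primitive f F beta (po_cont H) ltac:(lra)
  (po_RV H) (po_F H) (po_Finf H)
  (/ lam) (/ mu) e (Rinv_0_lt_compat _ Hlam) Hmu' He) as [d [Hd Hcmp]].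
rewrite Rpower_Rinv_l, Ropp_involutive in Hcmp by exact Hlam; fold P in Hcmp.
destruct (po_x0 H d Hd) as [M2 Hx0].
destruct (po_y0 H d Hd) as [M3 Hy0].
destruct (eventually_nonneg (fun t => mu * t - F (x t))
  (fun t => mu - (1 - g t / f (x t))) (Rmax (Rmax T M1) (Rmax M2 M3)) e He)
  as [M HM].
- intros t Ht.
  assert (HtT : T <= t) by (eapply Rle_trans; [|exact Ht]; eapply Rle_trans; apply Rmax_l).
  apply (derivable_pt_lim_minus (fun t => mu * t)).
  + apply is_derive_Reals; auto_derive; [exact I|ring].
  + now apply (po_zd H).
- intros t Ht Hneg.
  assert (Hm1 := Rmax_l (Rmax T M1) (Rmax M2 M3)).
  assert (Hm2 := Rmax_r (Rmax T M1) (Rmax M2 M3)).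
  assert (Hm3 := Rmax_l T M1); assert (Hm4 := Rmax_r T M1).
  assert (Hm5 := Rmax_l M2 M3); assert (Hm6 := Rmax_r M2 M3).
  destruct (po_y H t ltac:(lra)) as [Hy HFy].
  assert (Hx := po_x H t ltac:(lra)).
  assert (Hgt := po_g H t ltac:(lra)).
  specialize (Hg t ltac:(lra)); specialize (Hx0 t ltac:(lra)); specialize (Hy0 t ltac:(lra)).
  assert (Hcmp' : f (x t) <= (P + e) * f (y t)).
  { apply (Hcmp (y t) (x t) (conj Hy Hy0) (conj Hx Hx0)).
    apply Rmult_le_reg_l with mu; [exact Hmupos|].
    rewrite <- Rmult_assoc, Rinv_r, HFy; lra. }
  assert (Hf := po_pos H _ Hx).
  assert (Hfy := po_pos H _ Hy).
  assert (Hq : 1 - mu + e <= g t / f (x t)); [|lra].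
  apply Rmult_le_reg_r with (f (x t)); [exact Hf|].
  unfold Rdiv; rewrite Rmult_assoc, Rinv_l, Rmult_1_r by lra.
  (* For a nonpositive left factor the positivity of [g] suffices; otherwise the factor may multiply
     the bound on f (x t). *)
  destruct (Rle_dec (1 - mu + e) 0) as [Hle|Hnle]; [nra|].
  apply Rle_trans with (2 := Hg).
  apply Rle_trans with ((1 - mu + e) * ((P + e) * f (y t))).
  + apply Rmult_le_compat_l; lra.
  + rewrite <- Rmult_assoc; apply Rmult_le_compat_r; lra.
- exists M; intros t Ht; specialize (HM t Ht); simpl in HM; lra.
Qed.

(** The equation linking [lam] and [L] turns the conditions of both barriers into equalities at mu =
    lam^(1 - beta), r = L. Moving [mu] by eps / 2 either way makes them strict and leaves room to
    move r by eps lam^beta / 4. *)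
Lemma orbit_ratio_limit {f F g x y : R -> R} {beta T : R} :
  perturbed_orbit f F g x y beta T ->
  forall lam L, 0 < lam -> 0 <= L ->
  L * Rpower lam (- beta) = 1 - Rpower lam (1 - beta) ->
  lim_at_infty (fun t => g t / f (y t)) L ->
  lim_at_infty (fun t => F (x t) / t) (Rpower lam (1 - beta)).
Proof.
intros H lam L Hlam HL Heq Hlim eps Heps.
set (Lam := Rpower lam (1 - beta)) in *.
assert (HP := Rpower_pos lam beta).
assert (HQ : Rpower lam (- beta) = / Rpower lam beta) by apply Rpower_Ropp.
set (P := Rpower lam beta) in *.
assert (HL' : (1 - Lam) * P = L) by (rewrite <- Heq, HQ; field; lra).
assert (Hratio : forall t, T <= t -> g t = g t / f (y t) * f (y t) /\ 0 < f (y t)).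
{ intros t Ht; destruct (po_y H t Ht) as [Hy _].
  assert (Hf := po_pos H _ Hy). split; [field; lra|exact Hf]. }
assert (Heta : 0 < eps * P / 4) by nra.
destruct (Hlim _ Heta) as [M0 HM0].
assert (Hm1 := Rmax_l T M0); assert (Hm2 := Rmax_r T M0).
destruct (orbit_lower H lam (Lam - eps / 2) (L + eps * P / 4))
  as [M1 HM1]; fold Lam; try lra.
- rewrite Rmult_plus_distr_r, Heq, HQ.
  replace (eps * P / 4 * / P) with (eps / 4) by (field; lra); lra.
- exists (Rmax T M0); intros t Ht.
  destruct (Hratio t ltac:(lra)) as [-> Hf].
  specialize (HM0 t ltac:(lra)); apply Rabs_def2 in HM0.
  apply Rmult_le_compat_r; lra.
- destruct (orbit_upper H lam (Lam + eps / 2) (L - eps * P / 4))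
    as [M2 HM2]; fold Lam; fold P; try lra.
  + exists (Rmax T M0); intros t Ht.
    destruct (Hratio t ltac:(lra)) as [Hgt Hf]; rewrite Hgt.
    specialize (HM0 t ltac:(lra)); apply Rabs_def2 in HM0.
    apply Rmult_le_compat_r; lra.
  + exists (Rmax 1 (Rmax M1 M2)); intros t Ht.
    assert (Hm3 := Rmax_l 1 (Rmax M1 M2)); assert (Hm4 := Rmax_r 1 (Rmax M1 M2)).
    assert (Hm5 := Rmax_l M1 M2); assert (Hm6 := Rmax_r M1 M2).
    specialize (HM1 t ltac:(lra)); specialize (HM2 t ltac:(lra)).
    assert (Lam - eps / 2 <= F (x t) / t <= Lam + eps / 2).
    { split; apply Rmult_le_reg_r with t; try lra;
        replace (F (x t) / t * t) with (F (x t)) by (field; lra); lra. }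
    apply Rabs_def1; lra.
Qed.

Lemma orbit_sublinear {f F g x y : R -> R} {beta T : R} :
  perturbed_orbit f F g x y beta T ->
  tends_to_infty (fun t => g t / f (y t)) ->
  forall mu, 0 < mu -> exists M, forall t, M <= t -> F (x t) <= mu * t.
Proof.
intros H Hlim mu Hmu.
assert (Hb := po_beta H).
(* Any [lam] with lam^(1 - beta) < mu would do; this one gives mu / 2. The quotient then exceeds
   whatever threshold [orbit_upper] requires. *)
pose (lam := Rpower (mu / 2) (/ (1 - beta))).
assert (Hlam : Rpower lam (1 - beta) = mu / 2).
{ unfold lam; rewrite Rpower_mult, Rinv_l, Rpower_1; lra. }
destruct (Hlim ((1 - mu) * Rpower lam beta + 1)) as [M0 HM0].
apply (orbit_upper H lam mu ((1 - mu) * Rpower lam beta + 1)).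
- apply Rpower_pos.
- lra.
- lra.
- exists (Rmax T M0); intros t Ht.
  assert (Hm1 := Rmax_l T M0); assert (Hm2 := Rmax_r T M0).
  destruct (po_y H t ltac:(lra)) as [Hy _].
  assert (Hf := po_pos H _ Hy).
  specialize (HM0 t ltac:(lra)).
  replace (g t) with (g t / f (y t) * f (y t)) by (field; lra).
  apply Rmult_le_compat_r; lra.
Qed.

(** * Tracking of [g] by [f (x t)] when the quotient is unbounded *)

(** The substitution u = 1/t turns [g] into a function regularly varying at 0 with index [theta] >
    0. *)
Lemma RVinf_almost_decreasing (g : R -> R) (theta : R) :
  (forall t, 0 < t -> continuity_pt g t) -> 0 < theta -> RVinf g (- theta) ->
  forall K, 1 < K -> exists M, 0 < M /\
    forall s t, M <= s -> s <= t -> g t <= K * g s.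
Proof.
intros Hc Htheta [Hpos Hrv] K HK.
destruct (RV0_almost_increasing (fun u => g (/ u)) theta) with (K := K)
  as [d [Hd Hmono]]; [| exact Htheta | | exact HK |].
- intros u Hu; apply (continuity_pt_comp Rinv g).
  + apply derivable_continuous_pt, derivable_pt_inv; [lra|apply derivable_pt_id].
  + now apply Hc, Rinv_0_lt_compat.
- split.
  + intros u Hu; now apply Hpos, Rinv_0_lt_compat.
  + intros lam Hlam eps Heps.
    destruct (Hrv (/ lam) (Rinv_0_lt_compat _ Hlam) eps Heps) as [M HM].
    exists (/ (Rmax 1 M)).
    assert (Hm1 := Rmax_l 1 M); assert (Hm2 := Rmax_r 1 M).
    split; [apply Rinv_0_lt_compat; lra|]; intros u Hu.
    rewrite Rinv_mult, <- (Ropp_involutive theta), <- Rpower_Rinv_l by exact Hlam.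
    apply HM, Rle_trans with (1 := Hm2).
    rewrite <- (Rinv_inv (Rmax 1 M)); apply Rinv_le_contravar; lra.
- exists (2 / d); split; [apply Rdiv_lt_0_compat; lra|].
  intros s t Hs Hst.
  assert (Hs0 : 0 < 2 / d) by (apply Rdiv_lt_0_compat; lra).
  specialize (Hmono (/ t) (/ s)); rewrite !Rinv_inv in Hmono; apply Hmono.
  + apply Rinv_0_lt_compat; lra.
  + apply Rinv_le_contravar; lra.
  + apply Rle_lt_trans with (/ (2 / d)); [apply Rinv_le_contravar; lra|].
    replace (/ (2 / d)) with (d / 2) by (field; lra); lra.
Qed.

(** Choosing q with q^(- theta) = (1 + K) / 2 puts the limit of g (q t) / g t strictly below [K]. *)
Lemma RVinf_window (g : R -> R) (theta : R) :
  0 < theta -> RVinf g (- theta) ->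
  forall K, 1 < K -> exists q, 0 < q < 1 /\
    exists M, forall t, M <= t -> g (q * t) <= K * g t.
Proof.
intros Htheta [Hpos Hrv] K HK.
pose (q := Rpower ((1 + K) / 2) (- / theta)).
assert (Hq0 : 0 < q) by apply Rpower_pos.
assert (Hq : Rpower q (- theta) = (1 + K) / 2).
{ unfold q; rewrite Rpower_mult; replace (- / theta * - theta) with 1 by (field; lra).
  apply Rpower_1; lra. }
exists q; split; [split; [exact Hq0|]|].
- apply Rlt_le_trans with (Rpower ((1 + K) / 2) 0); [|right; apply Rpower_O; lra].
  apply Rpower_lt; [lra|]. assert (H := Rinv_0_lt_compat _ Htheta); lra.
- destruct (Hrv q Hq0 ((K - 1) / 2)) as [M HM]; [lra|].
  exists (Rmax 1 M); intros t Ht.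
  assert (Hm1 := Rmax_l 1 M); assert (Hm2 := Rmax_r 1 M).
  specialize (HM t ltac:(lra)); rewrite Hq in HM; apply Rabs_def2 in HM.
  assert (Hg := Hpos t ltac:(lra)).
  replace (g (q * t)) with (g (q * t) / g t * g t) by (field; lra).
  apply Rmult_le_compat_r; lra.
Qed.

(* On [q t, t] the function F o x cannot move at a speed bounded away from 0 throughout, as
   F (x t) = o(t); so f o x and g are comparable at some time in it. After the last such time x is
   monotone, and f and g vary little. *)
Lemma orbit_tracks {f F g x y : R -> R} {beta T theta : R} :
  perturbed_orbit f F g x y beta T ->
  (forall t, 0 < t -> continuity_pt g t) -> 0 < theta -> RVinf g (- theta) ->
  (forall mu, 0 < mu -> exists M, forall t, M <= t -> F (x t) <= mu * t) ->
  forall K, 1 < K -> exists M, forall t, M <= t ->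
    f (x t) <= K ^ 4 * g t /\ g t <= K ^ 4 * f (x t).
Proof.
intros H Hgc Htheta HgRV Hsub K HK.
destruct (RVinf_almost_decreasing g theta Hgc Htheta HgRV K HK) as [M1 [HM1 Hgdec]].
destruct (RVinf_window g theta Htheta HgRV K HK) as [q [Hq [M2 Hwin]]].
assert (Hb := po_beta H).
destruct (RV0_almost_increasing f beta) with (K := K) as [d [Hd Hfinc]];
  [intros u _; apply (po_cont H)|lra|apply (po_RV H)|exact HK|].
destruct (po_x0 H d Hd) as [M3 Hxd].
destruct (po_Finf H 0) as [d' [Hd' HF]].
destruct (po_x0 H d' Hd') as [M4 HxF].
assert (HKi : 0 < / K < 1).
{ split; [apply Rinv_0_lt_compat; lra|].
  rewrite <- Rinv_1; apply Rinv_lt_contravar; lra. }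
(* If f (x) and g differ by more than the factor [K], the speed 1 - g / f (x) is at least [kap] in
   absolute value: the first term serves for large f (x), the second for large g. *)
pose (kap := Rmin (1 - / K) (K - 1)).
assert (Hkap : 0 < kap) by (apply Rmin_pos; lra).
assert (Hkap1 : kap <= 1 - / K) by apply Rmin_l.
assert (Hkap2 : kap <= K - 1) by apply Rmin_r.
(* Speed [kap] throughout [q t, t] would move F (x) by kap (1 - q) t = 2 nu t, while F (x) stays in
   (0, nu t] on the window. *)
assert (Hnu : 0 < kap * (1 - q) / 2) by nra.
destruct (Hsub _ Hnu) as [M5 Hsmall].
set (nu := kap * (1 - q) / 2) in *.
pose (N := Rmax T (Rmax M1 (Rmax M2 (Rmax M3 (Rmax M4 M5))))).
assert (HN : T <= N /\ M1 <= N /\ M2 <= N /\ M3 <= N /\ M4 <= N /\ M5 <= N).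
{ unfold N.
  assert (A1 := Rmax_l T (Rmax M1 (Rmax M2 (Rmax M3 (Rmax M4 M5))))).
  assert (A2 := Rmax_r T (Rmax M1 (Rmax M2 (Rmax M3 (Rmax M4 M5))))).
  assert (A3 := Rmax_l M1 (Rmax M2 (Rmax M3 (Rmax M4 M5)))).
  assert (A4 := Rmax_r M1 (Rmax M2 (Rmax M3 (Rmax M4 M5)))).
  assert (A5 := Rmax_l M2 (Rmax M3 (Rmax M4 M5))).
  assert (A6 := Rmax_r M2 (Rmax M3 (Rmax M4 M5))).
  assert (A7 := Rmax_l M3 (Rmax M4 M5)); assert (A8 := Rmax_r M3 (Rmax M4 M5)).
  assert (A9 := Rmax_l M4 M5); assert (A10 := Rmax_r M4 M5).
  lra. }
assert (HT := po_T H).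
exists (N / q); intros t Ht.
assert (Hqt : N <= q * t).
{ replace N with (q * (N / q)) by (field; lra). apply Rmult_le_compat_l; lra. }
assert (Ht0 : 0 < t) by nra.
assert (Hqt' : q * t < t) by nra.
assert (Hgwin : forall s, q * t <= s <= t -> g s <= K * K * g t).
{ intros s Hs; assert (H1 := Hgdec (q * t) s ltac:(lra) ltac:(lra)).
  assert (H2 := Hwin t ltac:(lra)). nra. }
assert (Hz := fun s (Hs : q * t <= s <= t) => po_zd H s ltac:(lra)).
assert (Hfx : forall s, q * t <= s <= t -> 0 < f (x s)).
{ intros s Hs; apply (po_pos H), (po_x H); lra. }
assert (Hgx : forall s, q * t <= s <= t -> 0 < g s).
{ intros s Hs; apply (po_g H); lra. }
assert (Hzpos : forall s, q * t <= s <= t -> 0 < F (x s) <= nu * s).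
{ intros s Hs; split; [apply HF; split; [apply (po_x H)|apply HxF]|apply Hsmall]; lra. }
(* The mean value point [c] is the time at which f (x) and g are comparable; it seeds the search for
   the last such time in both halves. *)
assert (Hmove : exists c, F (x t) - F (x (q * t)) = (1 - g c / f (x c)) * (t - q * t)
                          /\ q * t < c < t).
{ apply (MVT_cor2 (fun s => F (x s)) (fun s => 1 - g s / f (x s))); [exact Hqt'|].
  exact Hz. }
destruct Hmove as [c [Hmove Hcqt]].
assert (Hz1 := Hzpos (q * t) ltac:(lra)); assert (Hz2 := Hzpos t ltac:(lra)).
assert (Hnut : nu * (q * t) < nu * t) by (apply Rmult_lt_compat_l; lra).
assert (Hkt : kap * (t - q * t) = 2 * (nu * t)) by (unfold nu; field).
assert (Hfc := Hfx c ltac:(lra)); assert (Hgc' := Hgx c ltac:(lra)).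
assert (Hxcont : forall s, q * t <= s <= t -> continuity_pt (fun s => f (x s)) s).
{ intros s Hs; apply (continuity_pt_comp x f); [|apply (po_cont H)].
  apply derivable_continuous_pt; exists (- f (x s) + g s); apply (po_xd H); lra. }
assert (Hgcont : forall s, q * t <= s <= t -> continuity_pt g s) by (intros s Hs; apply Hgc; lra).
assert (Hquot : g c / f (x c) * f (x c) = g c) by (field; lra).
set (w := g c / f (x c)) in *.
split; apply Rnot_lt_le; intros Hbad.
- assert (Hgt := Hgx t ltac:(lra)).
  assert (HK4 : K * g t <= K ^ 4 * g t).
  { apply Rmult_le_compat_r; [lra|]. rewrite <- (pow_1 K) at 1; apply Rle_pow; [lra|lia]. }
  destruct (last_nonneg (fun s => K * g s - f (x s)) (q * t) t c) as [s [Hs [Hhs Hlast]]].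
  + intros s Hs; apply continuity_pt_minus; [|now apply Hxcont].
    now apply continuity_pt_scal, Hgcont.
  + lra.
  + apply Rnot_lt_le; intros Hneg.
    assert (Hw : w <= / K).
    { apply Rmult_le_reg_r with (f (x c)); [exact Hfc|].
      apply Rmult_le_reg_l with K; [lra|].
      rewrite Hquot, <- Rmult_assoc, Rinv_r; lra. }
    assert (kap * (t - q * t) <= (1 - w) * (t - q * t)) by (apply Rmult_le_compat_r; lra).
    lra.
  + lra.
  (* After s one has f (x) > K g > g, so x decreases. The four factors [K] come from f between x t
     and x s, from the inequality at s, and two from g over the window. *)
  + assert (Hxst : x t <= x s).
    { apply (decreasing_of_derive x (fun u => - f (x u) + g u)); [lra| |].
      - intros u Hu; apply (po_xd H); lra.
      - intros u Hu; assert (Hu1 := Hlast u ltac:(lra)); simpl in Hu1.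
        assert (Hu2 := Hgx u ltac:(lra)). nra. }
    assert (H1 : f (x t) <= K * f (x s)).
    { apply Hfinc; [apply (po_x H); lra|exact Hxst|apply Hxd; lra]. }
    assert (H2 := Hgwin s ltac:(lra)).
    assert (H3 : K * f (x s) <= K * (K * (K * K * g t))).
    { apply Rmult_le_compat_l; [lra|]. apply Rle_trans with (K * g s); [lra|].
      apply Rmult_le_compat_l; lra. }
    replace (K ^ 4 * g t) with (K * (K * (K * K * g t))) in Hbad by ring. lra.
- assert (Hft := Hfx t ltac:(lra)).
  assert (HK4 : K * (K * (K * f (x t))) <= K ^ 4 * f (x t)).
  { replace (K * (K * (K * f (x t)))) with (K ^ 3 * f (x t)) by ring.
    apply Rmult_le_compat_r; [lra|]. apply Rle_pow; [lra|lia]. }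
  assert (HK1 : K * f (x t) <= K * (K * (K * f (x t)))).
  { replace (K * (K * (K * f (x t)))) with (K ^ 3 * f (x t)) by ring.
    apply Rmult_le_compat_r; [lra|]. rewrite <- (pow_1 K) at 1; apply Rle_pow; [lra|lia]. }
  destruct (last_nonneg (fun s => K * f (x s) - g s) (q * t) t c) as [s [Hs [Hhs Hlast]]].
  + intros s Hs; apply continuity_pt_minus; [|now apply Hgcont].
    now apply continuity_pt_scal, Hxcont.
  + lra.
  + apply Rnot_lt_le; intros Hneg.
    assert (Hw : K <= w).
    { apply Rmult_le_reg_r with (f (x c)); [exact Hfc|]. rewrite Hquot; lra. }
    assert ((1 - w) * (t - q * t) <= - kap * (t - q * t)) by (apply Rmult_le_compat_r; lra).
    lra.
  + lra.
  (* Now g > K f (x) after s, so x increases. Going from s to t costs g a single factor, so the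
     total is K^3, below K^4. *)
  + assert (Hxst : - x t <= - x s).
    { apply (decreasing_of_derive (fun u => - x u) (fun u => - (- f (x u) + g u))); [lra| |].
      - intros u Hu; apply (derivable_pt_lim_opp x), (po_xd H); lra.
      - intros u Hu; assert (Hu1 := Hlast u ltac:(lra)); simpl in Hu1.
        assert (Hu2 := Hfx u ltac:(lra)). nra. }
    assert (H1 : f (x s) <= K * f (x t)).
    { apply Hfinc; [apply (po_x H); lra|lra|apply Hxd; lra]. }
    assert (H2 := Hgdec s t ltac:(lra) ltac:(lra)).
    assert (H3 : K * g s <= K * (K * (K * f (x t)))).
    { apply Rmult_le_compat_l; [lra|]. apply Rle_trans with (K * f (x s)); [lra|].
      apply Rmult_le_compat_l; lra. }
    lra.
Qed.

(** Taking [K] as the fourth root of 1 + e confines the quotient to [1/(1 + e), 1 + e], and 1/(1 +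
    e) >= 1 - e. *)
Lemma orbit_quotient_limit {f F g x y : R -> R} {beta T theta : R} :
  perturbed_orbit f F g x y beta T ->
  (forall t, 0 < t -> continuity_pt g t) -> 0 < theta -> RVinf g (- theta) ->
  tends_to_infty (fun t => g t / f (y t)) ->
  lim_at_infty (fun t => f (x t) / g t) 1.
Proof.
intros H Hgc Htheta HgRV Hlim eps Heps.
pose (e := Rmin (eps / 2) (1 / 2)).
assert (He : 0 < e) by (apply Rmin_pos; lra).
assert (He1 : e <= eps / 2) by apply Rmin_l.
pose (K := sqrt (sqrt (1 + e))).
assert (HK : 1 < K).
{ assert (Hsqrt : forall v, 1 < v -> 1 < sqrt v).
  { intros v Hv; rewrite <- sqrt_1 at 1; apply sqrt_lt_1_alt; lra. }
  unfold K; apply Hsqrt, Hsqrt; lra. }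
assert (HK4 : K ^ 4 = 1 + e).
{ replace (K ^ 4) with ((K * K) * (K * K)) by ring.
  unfold K; rewrite sqrt_sqrt by apply sqrt_pos; apply sqrt_sqrt; lra. }
destruct (orbit_tracks H Hgc Htheta HgRV (orbit_sublinear H Hlim) K HK) as [M HM].
rewrite HK4 in HM.
exists (Rmax T M); intros t Ht.
assert (Hm1 := Rmax_l T M); assert (Hm2 := Rmax_r T M).
destruct (HM t ltac:(lra)) as [H1 H2].
assert (Hg := po_g H t ltac:(lra)).
assert (Hq : f (x t) / g t * g t = f (x t)) by (field; lra).
set (w := f (x t) / g t) in *.
assert (Hw1 : w <= 1 + e) by (apply Rmult_le_reg_r with (g t); lra).
assert (Hw2 : 1 <= (1 + e) * w).
{ apply Rmult_le_reg_r with (g t); [exact Hg|]. rewrite Rmult_assoc, Hq; lra. }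
assert (Hw3 : (1 + e) * (1 - e) <= (1 + e) * w) by nra.
apply Rmult_le_reg_l in Hw3; [|lra].
apply Rabs_def1; lra.
Qed.

(** * The algebraic equation for the limit *)

(** For positive u the equation is equivalent to u + L u^gam = 1, whose left side is continuous and
    strictly increasing. *)
Lemma root_exists (gam L : R) : 1 < gam -> 0 < L ->
  exists Lam, 0 < Lam < 1 /\ (1 - Lam) * Rpower Lam (- gam) = L /\
    forall mu, 0 < mu < 1 -> (1 - mu) * Rpower mu (- gam) = L -> mu = Lam.
Proof.
intros Hgam HL.
assert (Heq : forall u, 0 < u -> ((1 - u) * Rpower u (- gam) = L <-> u + L * Rpower u gam = 1)).
{ intros u Hu; assert (HP := Rpower_pos u gam); rewrite Rpower_Ropp; split; intros E.
  - rewrite <- E; field; lra.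
  - replace (1 - u) with (L * Rpower u gam) by lra. field; lra. }
assert (Hinc : forall u v, 0 < u < v -> u + L * Rpower u gam < v + L * Rpower v gam).
{ intros u v Huv; assert (H := Rlt_Rpower_l u v gam ltac:(lra) Huv). nra. }
(* Since a^gam <= a, the left side at [a] is at most a (1 + L) < 1, so [a] can be the lower end of
   the bracket. *)
pose (a := / (2 + L)).
assert (Ha : 0 < a < 1).
{ split; [apply Rinv_0_lt_compat; lra|]. rewrite <- Rinv_1; apply Rinv_lt_contravar; lra. }
assert (HaL : a * (2 + L) = 1) by (unfold a; field; lra).
assert (Haga : Rpower a gam <= a).
{ assert (H : Rpower a (gam - 1) <= 1) by
    (apply Rle_trans with (Rpower 1 (gam - 1));
      [apply Rle_Rpower_l; lra|rewrite Rpower_1_l; lra]).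
  replace gam with ((gam - 1) + 1) by ring.
  rewrite Rpower_plus, Rpower_1 by lra. nra. }
destruct (IVT_interv (fun u => u + L * Rpower u gam - 1) a 1) as [Lam [HLam HLam0]].
- intros u Hu; apply derivable_continuous_pt.
  exists (1 + L * (gam * Rpower u (gam - 1)) - 0).
  apply (derivable_pt_lim_minus (fun u => u + L * Rpower u gam) (fct_cte 1)).
  + apply (derivable_pt_lim_plus id); [apply derivable_pt_lim_id|].
    apply (derivable_pt_lim_scal (fun u => Rpower u gam)), derivable_pt_lim_power; lra.
  + apply derivable_pt_lim_const.
- lra.
- nra.
- rewrite Rpower_1_l; lra.
- assert (HLam1 : Lam < 1).
  { destruct (proj2 HLam) as [Hl| ->]; [exact Hl|]. rewrite Rpower_1_l in HLam0; lra. }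
  exists Lam; split; [lra|]; split; [apply Heq; lra|].
  intros mu Hmu Emu; apply Heq in Emu; [|lra].
  destruct (Rtotal_order mu Lam) as [Hlt|[E|Hgt]]; [|exact E|].
  + specialize (Hinc mu Lam); lra.
  + specialize (Hinc Lam mu); lra.
Qed.

(** * Pointwise continuity and positivity of the solution *)

Lemma continuous_on_nonneg_pt (h : R -> R) (t : R) :
  continuous_on_nonneg h -> 0 < t -> continuity_pt h t.
Proof.
intros Hc Ht eps Heps.
destruct (Hc t (Rlt_le _ _ Ht) eps Heps) as [d [Hd H]].
exists (Rmin d t); split; [now apply Rmin_pos|].
intros s [_ Hs]; simpl in *; unfold Rdist in *.
assert (Hm1 := Rmin_l d t); assert (Hm2 := Rmin_r d t).
apply H; [|lra].
apply Rabs_def2 in Hs; lra.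
Qed.

(** Below 0 both - f (x) and g push x upwards, so x stays nonnegative. A later zero would be an
    interior minimum, where the derivative vanishes, yet there it equals g t > 0. *)
Lemma solution_pos (f g x : R -> R) :
  f 0 = 0 -> (forall u, u < 0 -> f u < 0) -> (forall t, 0 < t -> 0 < g t) ->
  continuous_on_nonneg x -> 0 < x 0 ->
  (forall t, 0 < t -> derivable_pt_lim x t (- f (x t) + g t)) ->
  exists T, 0 < T /\ forall t, T <= t -> 0 < x t.
Proof.
intros Hf0 Hfneg Hg Hxc Hx0 Hxd.
destruct (Hxc 0 (Rle_refl 0) (x 0) Hx0) as [d [Hd Hnear]].
assert (Hstart : 0 < x (d / 2)).
{ specialize (Hnear (d / 2) ltac:(lra)).
  rewrite Rminus_0_r, Rabs_pos_eq in Hnear by lra.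
  specialize (Hnear ltac:(lra)); apply Rabs_def2 in Hnear; lra. }
assert (Hnn : forall t, d / 2 <= t -> 0 <= x t).
{ apply (stays_nonneg x (fun t => - f (x t) + g t)); [| |lra].
  - intros t Ht; apply Hxd; lra.
  - intros t Ht Hneg; specialize (Hfneg _ Hneg); specialize (Hg t ltac:(lra)); lra. }
exists d; split; [exact Hd|]; intros t Ht.
destruct (Hnn t ltac:(lra)) as [Hp|Hz]; [exact Hp|exfalso].
assert (Hpr := Hxd t ltac:(lra)).
rewrite <- Hz, Hf0 in Hpr.
assert (Hder := deriv_minimum x (d / 2) (t + 1) t (exist _ _ Hpr) ltac:(lra) ltac:(lra)).
specialize (Hg t ltac:(lra)).
assert (E : - 0 + g t = 0); [|lra].
apply Hder; intros u Hu _; rewrite <- Hz; apply Hnn; lra.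
Qed.

Theorem theorem6
  (f g : R -> R) (xi : R) (x : R -> R) (beta theta : R)
  (Hfc : continuity f) (Hflip : locally_lipschitz f)
  (Hf0 : f 0 = 0) (Hfsign : forall u, u <> 0 -> u * f u > 0)
  (Hgc : continuous_on_nonneg g) (Hgpos : forall t, 0 < t -> g t > 0)
  (Hxi : 0 < xi)
  (Hxc : continuous_on_nonneg x) (Hx0 : x 0 = xi)
  (Hxd : forall t, 0 < t -> derivable_pt_lim x t (- f (x t) + g t))
  (Hbeta : 1 < beta) (HfRV : RV0 f beta)
  (Htheta : 0 < theta) (HgRV : RVinf g (- theta))
  (Hxlim : lim_at_infty x 0) :
  let F := Fof f in
  let ratio := fun t => g t / f (Finv F t) in
  (lim_at_infty ratio 0 ->
     lim_at_infty (fun t => F (x t) / t) 1) /\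
  (forall L, 0 < L -> lim_at_infty ratio L ->
     exists Lam, 0 < Lam < 1 /\
       (1 - Lam) * Rpower Lam (- (beta / (beta - 1))) = L /\
       (forall mu, 0 < mu < 1 ->
          (1 - mu) * Rpower mu (- (beta / (beta - 1))) = L -> mu = Lam) /\
       lim_at_infty (fun t => F (x t) / t) Lam) /\
  (tends_to_infty ratio ->
     lim_at_infty (fun t => f (x t) / g t) 1).

Proof.
intros F ratio.
assert (Hfpos : forall u, 0 < u -> 0 < f u) by exact (proj1 HfRV).
assert (Hfneg : forall u, u < 0 -> f u < 0).
{ intros u Hu; specialize (Hfsign u ltac:(lra)); nra. }
assert (HF := Fof_derive f Hfc Hfpos); fold F in HF.
assert (HFinf := Fof_infty f Hfc Hfpos Hf0 Hflip); fold F in HFinf.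
assert (HFinv : forall t, 0 < t -> 0 < Finv F t /\ F (Finv F t) = t).
{ intros t Ht; apply Finv_spec; [|exact HFinf|unfold F; now rewrite Fof_1].
  intros u Hu; apply derivable_continuous_pt; exists (- / f u); now apply HF. }
destruct (solution_pos f g x Hf0 Hfneg Hgpos Hxc ltac:(now rewrite Hx0) Hxd) as [T [HT Hxpos]].
assert (Horbit : perturbed_orbit f F g x (Finv F) beta T).
{ split; try assumption.
  - intros t Ht; apply Hgpos; lra.
  - intros t Ht; apply Hxd; lra.
  - intros d Hd; destruct (Hxlim d Hd) as [M HM]; exists M; intros t Ht.
    specialize (HM t Ht); apply Rabs_def2 in HM; lra.
  - intros t Ht; apply HFinv; lra.
  (* If [Finv F t] were at least d, then t = F (Finv F t) <= F d; the maximum with 1 keeps t in the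
     range where [Finv] inverts [F]. *)
  - intros d Hd; exists (Rmax 1 (F d + 1)); intros t Ht.
    assert (Hm1 := Rmax_l 1 (F d + 1)); assert (Hm2 := Rmax_r 1 (F d + 1)).
    destruct (HFinv t ltac:(lra)) as [Hy HFy].
    apply Rnot_le_lt; intros [Hlt|Heq].
    + assert (H := primitive_strictly_decreasing f F Hfpos HF d (Finv F t) Hd Hlt); lra.
    + rewrite <- Heq in HFy; lra. }
assert (Hgt : forall t, 0 < t -> continuity_pt g t).
{ intros t Ht; now apply continuous_on_nonneg_pt. }
split; [|split].
- intros HL; rewrite <- (Rpower_1_l (1 - beta)).
  (* For L = 0 the balance equation is solved by lam = 1. *)
  apply (orbit_ratio_limit Horbit 1 0); [lra|lra| |exact HL].
  rewrite !Rpower_1_l; ring.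
- intros L HLpos HL.
  assert (Hgam : 1 < beta / (beta - 1)).
  { apply Rmult_lt_reg_r with (beta - 1); [lra|].
    unfold Rdiv; rewrite Rmult_assoc, Rinv_l; lra. }
  destruct (root_exists _ L Hgam HLpos) as [Lam [HLam [HLamL Huniq]]].
  exists Lam; repeat split; try assumption; try lra.
  (* This inverts Lam = lam^(1 - beta); then lam^(- beta) = Lam^(beta / (beta - 1)), and the
     equation for [Lam] becomes the one required of [lam]. *)
  pose (lam := Rpower Lam (- / (beta - 1))).
  assert (E1 : Rpower lam (1 - beta) = Lam).
  { unfold lam; rewrite Rpower_mult.
    replace (- / (beta - 1) * (1 - beta)) with 1 by (field; lra).
    apply Rpower_1; lra. }
  assert (E2 : Rpower lam (- beta) = / Rpower Lam (- (beta / (beta - 1)))).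
  { unfold lam; rewrite Rpower_mult, <- Rpower_Ropp; f_equal; field; lra. }
  rewrite <- E1.
  apply (orbit_ratio_limit Horbit lam L); [apply Rpower_pos|lra| |exact HL].
  rewrite E1, E2, <- HLamL.
  assert (HP := Rpower_pos Lam (- (beta / (beta - 1)))); field; lra.
- intros HL; exact (orbit_quotient_limit Horbit Hgt Htheta HgRV HL).
Qed.
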